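(* For all natural numbers $n$, $$\gamma(Q_{n\times n})\ \ge\ \beta(Q_{n\times n})\ \ge\ (n-1)/2.$$
   Context: Natural numbers are positive integers. The squares (cells) of the $n\times n$ chessboard are $V(Q_{n\times n})=\{(x,y): 0\le x,y\le n-1\}$, with $x$ the column number and $y$ the row number. A column is a set of all cells with a fixed $x$; a row is a set of all cells with a fixed $y$; a sum diagonal is a (nonempty) set of all cells with a fixed value of $x+y$; a difference diagonal is a (nonempty) set of all cells with a fixed value of $x-y$. The Queen's graph $Q_{n\times n}$ has vertex set $V(Q_{n\times n})$, two distinct cells being adjacent if they lie in a common row, column, sum diagonal or difference diagonal. $\gamma(Q_{n\times n})$ is the minimum size of a dominating set of $Q_{n\times n}$, i.e. of a set $\mathcal D$ of cells such that every cell is in $\mathcal D$ or adjacent to an element of $\mathcal D$. $\beta(Q_{n\times n})$ (Relaxed Queen's Domination) is the least number $p$ such that there exist rows $R_0,\dots,R_{p-1}$, columns $C_0,\dots,C_{p-1}$, sum diagonals $S_0,\dots,S_{p-1}$ and difference diagonals $D_0,\dots,D_{p-1}$ (repetitions allowed) with $V(Q_{n\times n})=\bigcup_i R_i\cup\bigcup_i C_i\cup\bigcup_i S_i\cup\bigcup_i D_i$. *)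

(* Defs.v *)
From mathcomp Require Import all_boot all_order all_algebra.

Set Implicit Arguments.
Unset Strict Implicit.
Unset Printing Implicit Defensive.

Import GRing.Theory Num.Theory.

(* A cell is a pair (x, y) = (column number, row number). *)
Definition cell (n : nat) : finType := ('I_n * 'I_n)%type.

Section Lines.

Variable n : nat.

Definition row_no (c : cell n) : nat := c.2.
Definition col_no (c : cell n) : nat := c.1.
Definition sum_no (c : cell n) : nat := c.1 + c.2.
Definition diff_no (c : cell n) : int := (c.1%:Z - c.2%:Z)%R.

(* [preim_partition f setT] is the set of the nonempty fibres of f. *)
Definition rows : {set {set cell n}} := preim_partition row_no [set: cell n].
Definition cols : {set {set cell n}} := preim_partition col_no [set: cell n].
Definition sum_diags : {set {set cell n}} :=
  preim_partition sum_no [set: cell n].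
Definition diff_diags : {set {set cell n}} :=
  preim_partition diff_no [set: cell n].

Definition in_common (Ls : {set {set cell n}}) (c d : cell n) : bool :=
  [exists L in Ls, (c \in L) && (d \in L)].

Definition queen_adj : rel (cell n) := fun c d =>
  (c != d) && [|| in_common rows c d, in_common cols c d,
                  in_common sum_diags c d | in_common diff_diags c d].

End Lines.

Definition dominating (T : finType) (e : rel T) (D : {set T}) : bool :=
  [forall v, (v \in D) || [exists u in D, e v u]].

Lemma dominating_card_ex (T : finType) (e : rel T) :
  exists k, [exists D : {set T}, dominating e D && (#|D| == k)].
Proof.
exists #|[set: T]|; apply/existsP; exists [set: T]; rewrite eqxx andbT.
by apply/forallP => v; rewrite inE.
Qed.

Definition domination_number (T : finType) (e : rel T) : nat :=
  ex_minn (dominating_card_ex e).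

Definition gammaQ (n : nat) : nat := domination_number (@queen_adj n).

Definition covered_by (n p : nat) : bool :=
  [exists R : {ffun 'I_p -> {set cell n}},
   exists C : {ffun 'I_p -> {set cell n}},
   exists S : {ffun 'I_p -> {set cell n}},
   exists D : {ffun 'I_p -> {set cell n}},
   [&& [forall i, R i \in rows n], [forall i, C i \in cols n],
       [forall i, S i \in sum_diags n], [forall i, D i \in diff_diags n]
     & [set: cell n] == (\bigcup_i R i) :|: (\bigcup_i C i)
                          :|: (\bigcup_i S i) :|: (\bigcup_i D i)]].

Lemma covered_by_ex (n : nat) : exists p, covered_by n p.
Proof.
exists n.
pose F (rT : eqType) (f : cell n -> rT) : {ffun 'I_n -> {set cell n}} :=
  [ffun i => [set c in [set: cell n] | f (i, i) == f c]].
have FP (rT : eqType) (f : cell n -> rT) :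
    [forall i, F rT f i \in preim_partition f [set: cell n]].
  by apply/forallP => i; rewrite ffunE; apply: imset_f; rewrite inE.
apply/existsP; exists (F _ (@row_no n)); apply/existsP; exists (F _ (@col_no n)).
apply/existsP; exists (F _ (@sum_no n)); apply/existsP; exists (F _ (@diff_no n)).
rewrite /rows /cols /sum_diags /diff_diags !FP /= eq_sym -subTset.
apply/subsetP => c _; rewrite !in_setU.
suff -> : c \in \bigcup_i F _ (@row_no n) i by [].
by apply/bigcupP; exists c.2 => //; rewrite ffunE !inE /=.
Qed.

Definition betaQ (n : nat) : nat := ex_minn (covered_by_ex n).

(* Main.v *)
Require Import Defs.
From mathcomp Require Import all_boot all_order all_algebra.
From mathcomp Require Import zify.

(** A dominating set of queens gives a relaxed cover: replace each queen by the
    four lines through it ([covered_by_dominating]). This is the inequality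
    between the two parameters.

    For the lower bound, let [p] lines of each direction cover the board, and
    call a row or column free if it is not one of the chosen lines. At least
    [n - p] rows and [n - p] columns are free, and the cells where a free row
    meets a free column must all be covered by the [2p] diagonals. After
    possibly transposing the board, the extreme free columns [a <= b] are at
    least as far apart as the extreme free rows [c <= d]. Keep only the cells
    of the columns [a] and [b] in free rows other than [d]. Those rows are
    pairwise less than [b - a] apart, whereas a diagonal leaving column [a]
    arrives in column [b] exactly [b - a] rows away; so no diagonal contains
    two of the kept cells. Hence [2 (n - p - 1) <= 2 p], that is
    [n <= 2 p + 1]. The diagonal count is [card_le_diagonals], and the choice
    of the extreme lines is [card_rows_le_diagonals]. *)

Set Implicit Arguments.
Unset Strict Implicit.
Unset Printing Implicit Defensive.

Import Order.TTheory GRing.Theory Num.Theory.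

(** A diagonal meets each of the columns [a] and [b] at most once, and its two
    meeting points lie [b - a] rows apart; so distinct cells of the two columns
    in the rows [U] use up distinct diagonals. *)
Lemma card_le_diagonals (a b : int) (U S D : seq int) :
    (a < b)%R -> uniq U -> {in U &, forall y z, (y - z < b - a)%R} ->
    {in [:: a; b] & U, forall x y, ((x + y)%R \in S) || ((x - y)%R \in D)} ->
  (size U).*2 <= size S + size D.
Proof.
move=> lt_ab uU closeU covU.
pose cells := [seq (x, y) | x <- [:: a; b], y <- U].
(* The tag records the direction of the diagonal chosen to cover a cell. *)
pose diag (c : int * int) : bool * int :=
  if (c.1 + c.2)%R \in S then (true, c.1 + c.2)%R else (false, c.1 - c.2)%R.
have cellsP c : c \in cells -> (c.1 \in [:: a; b]) /\ (c.2 \in U).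
  by case/allpairsP=> -[x y] /= [xab yU ->].
have ucells : uniq cells.
  apply: allpairs_uniq => //; last by move=> [? ?] [? ?].
  by rewrite /= inE andbT; lia.
have diag_inj : {in cells &, injective diag}.
  move=> [x y] [x' y'] /cellsP[/= xab yU] /cellsP[/= x'ab y'U].
  have lt1 := closeU _ _ yU y'U; have lt2 := closeU _ _ y'U yU.
  move: xab x'ab; rewrite !inE /diag /= => xab x'ab.
  by case: ifP => _; case: ifP => _ // [] eq_diag; congr pair; lia.
have -> : (size U).*2 = size (map diag cells).
  by rewrite size_map size_allpairs /= mul2n.
rewrite -(size_map (pair true) S) -(size_map (pair false) D) -size_cat.
apply: uniq_leq_size; first by rewrite map_inj_in_uniq.
move=> _ /mapP[[x y] /cellsP[/= xab yU] ->]; rewrite mem_cat /diag /=.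
have := covU _ _ xab yU.
by case: ifP => [xyS _|_ /= xyD]; rewrite map_f ?orbT.
Qed.

Lemma ord_extremes n (A : {set 'I_n}) :
    A != set0 ->
  exists lo hi : 'I_n,
    [/\ lo \in A, hi \in A & {in A, forall i : 'I_n, lo <= i <= hi}].
Proof.
case/set0Pn=> i0 Ai0.
case: (arg_minnP (fun i : 'I_n => i : nat) Ai0) => lo Alo lo_le.
case: (arg_maxnP (fun i : 'I_n => i : nat) Ai0) => hi Ahi hi_ge.
by exists lo, hi; split=> // i Ai; rewrite lo_le //=; apply: hi_ge.
Qed.

(** Dropping the extreme free row [d] makes the remaining free rows strictly
    closer together than the columns [a] and [b]. *)
Lemma card_rows_le_diagonals n (A : {set 'I_n}) (a b c d : 'I_n)
    (S D : seq int) :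
    d \in A -> {in A, forall y : 'I_n, c <= y <= d} ->
    a <= b -> d - c <= b - a ->
    (forall x y : 'I_n, x \in [:: a; b] -> y \in A ->
       ((x%:Z + y%:Z)%R \in S) || ((x%:Z - y%:Z)%R \in D)) ->
  #|A|.*2 <= size S + size D + 2.
Proof.
move=> Ad boundA le_ab le_width covA.
have cardA : #|A| = #|A :\ d|.+1 by rewrite (cardsD1 d) Ad.
have [lt_ab|ge_ab] := ltnP a b; last first.
  (* If [a = b] then [c = d], and [d] is the only free row. *)
  suff /eqP A0 : A :\ d == set0 by rewrite cardA A0 cards0 addn2.
  apply/set0Pn=> -[y /setD1P[neq_yd Ay]]; have := boundA _ Ay.
  by move: neq_yd; rewrite -val_eqE /=; have := boundA _ Ad; lia.
rewrite cardA doubleS -addn2 leq_add2r cardE.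
rewrite -(size_map (fun y : 'I_n => y%:Z%R)).
apply: (@card_le_diagonals a b) => //.
- rewrite map_inj_uniq ?enum_uniq // => y z [] eq_yz; exact: val_inj.
- move=> _ _ /mapP[y + ->] /mapP[z + ->].
  rewrite !mem_enum => /setD1P[neq_yd Ay] /setD1P[_ Az].
  move: neq_yd; rewrite -val_eqE /=.
  by have := boundA _ Ay; have := boundA _ Az; lia.
- move=> x _ xab /mapP[y + ->]; rewrite mem_enum => /setD1P[_ Ay].
  move: xab; rewrite !inE => /orP[]/eqP->; apply: covA => //;
    by rewrite !inE eqxx ?orbT.
Qed.

(** Transposing the board keeps sum diagonals and negates the numbers of the
    difference diagonals, so the wider of the two free sets may be taken to be
    the columns. *)
Lemma minn_card_le_diagonals n (A B : {set 'I_n}) (S D : seq int) :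
    (forall x y : 'I_n, x \in B -> y \in A ->
       ((x%:Z + y%:Z)%R \in S) || ((x%:Z - y%:Z)%R \in D)) ->
  (minn #|A| #|B|).*2 <= size S + size D + 2.
Proof.
move=> cov.
have [->|A0] := eqVneq A set0; first by rewrite cards0 min0n.
have [->|B0] := eqVneq B set0; first by rewrite cards0 minn0.
have [c [d [Ac Ad boundA]]] := ord_extremes A0.
have [a [b [Ba Bb boundB]]] := ord_extremes B0.
have /andP[_ le_cd] := boundA _ Ac; have /andP[_ le_ab] := boundB _ Ba.
have [le_width|/ltnW le_width] := leqP (d - c) (b - a).
  apply: leq_trans (_ : #|A|.*2 <= _); first by rewrite leq_double geq_minl.
  apply: (card_rows_le_diagonals Ad boundA le_ab le_width) => x y.
  by rewrite !inE => /orP[]/eqP->; apply: cov.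
apply: leq_trans (_ : #|B|.*2 <= _); first by rewrite leq_double geq_minr.
rewrite -(size_map (@GRing.opp int) D).
apply: (card_rows_le_diagonals Bb boundB le_cd le_width) => y x yA Bx.
have Ay : y \in A by move: yA; rewrite !inE => /orP[]/eqP->.
have /orP[xyS|xyD] := cov _ _ Bx Ay; first by rewrite addrC xyS.
by rewrite -opprB map_f ?orbT.
Qed.

Lemma mem_fibresP (T : finType) (rT : eqType) (f : T -> rT) (L : {set T}) :
  reflect (exists c, L = [set d | f c == f d])
          (L \in preim_partition f [set: T]).
Proof.
apply: (iffP imsetP) => [[c _ ->]|[c ->]]; exists c => //.
  by apply/setP=> d; rewrite !inE.
by apply/setP=> d; rewrite !inE.
Qed.

(** Every line is named by any one of its cells, so a relaxed cover amounts to
    four families of [p] cells, one for each direction. *)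
Lemma covered_byP n p :
  reflect (exists r c s d : 'I_p -> cell n, forall v : cell n, exists i,
             [|| row_no (r i) == row_no v, col_no (c i) == col_no v,
                 sum_no (s i) == sum_no v | diff_no (d i) == diff_no v])
          (covered_by n p).
Proof.
have repr (rT : eqType) (f : cell n -> rT) (F : {ffun 'I_p -> {set cell n}}) :
    [forall i, F i \in preim_partition f [set: cell n]] ->
  exists g : 'I_p -> cell n, forall i, F i = [set v | f (g i) == f v].
  move=> /forallP F_fib.
  have /fin_all_exists[g gP] i : exists c, F i = [set v | f c == f v].
    exact/mem_fibresP.
  by exists g.
apply: (iffP idP).
  case/existsP=> R /existsP[C] /existsP[S] /existsP[D].
  case/and5P=> /repr[r Rr] /repr[c Cc] /repr[s Ss] /repr[d Dd] /eqP cov.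
  exists r, c, s, d => v; have : v \in [set: cell n] by rewrite inE.
  rewrite cov !in_setU -!orbA => /or4P[] /bigcupP[i _ vi]; exists i;
    by move: vi; rewrite ?Rr ?Cc ?Ss ?Dd inE => ->; rewrite ?orbT.
case=> r [c [s [d cov]]].
pose F (rT : eqType) (f : cell n -> rT) (g : 'I_p -> cell n) :=
  [ffun i => [set v | f (g i) == f v]] : {ffun 'I_p -> {set cell n}}.
have F_fib (rT : eqType) (f : cell n -> rT) g :
    [forall i, F rT f g i \in preim_partition f [set: cell n]].
  by apply/forallP=> i; apply/mem_fibresP; exists (g i); rewrite ffunE.
have F_cov (rT : eqType) (f : cell n -> rT) g i v :
    f (g i) == f v -> v \in \bigcup_j F rT f g j.
  by move=> fv; apply/bigcupP; exists i; rewrite // ffunE inE.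
apply/existsP; exists (F _ (@row_no n) r); apply/existsP.
exists (F _ (@col_no n) c); apply/existsP; exists (F _ (@sum_no n) s).
apply/existsP; exists (F _ (@diff_no n) d); apply/and5P; split=> //.
rewrite eq_sym -subTset; apply/subsetP=> v _; rewrite !in_setU -!orbA.
by have [i /or4P[]/F_cov->] := cov v; rewrite ?orbT.
Qed.

Lemma in_common_fibres n (rT : eqType) (f : cell n -> rT) u v :
  in_common (preim_partition f [set: cell n]) u v -> f u = f v.
Proof.
case/existsP=> L /andP[/mem_fibresP[c ->]]; rewrite !inE.
by case/andP=> /eqP<- /eqP.
Qed.

Lemma covered_by_dominating n (D : {set cell n}) :
  dominating (@queen_adj n) D -> covered_by n #|D|.
Proof.
move/forallP=> domD; pose q (i : 'I_#|D|) := enum_val i.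
apply/covered_byP; exists q, q, q, q => v.
have [Dv|/existsP[u /andP[Du /andP[_ adj]]]] := orP (domD v).
  by exists (enum_rank_in Dv v); rewrite /q enum_rankK_in // eqxx.
exists (enum_rank_in Du u); rewrite /q enum_rankK_in //.
by case/or4P: adj => /in_common_fibres->; rewrite eqxx ?orbT.
Qed.

Lemma leq_card_setC_image m n (f : 'I_m -> 'I_n) :
  n - m <= #|~: [set f i | i : 'I_m]|.
Proof.
have := leq_imset_card f 'I_m; rewrite card_ord => le_im.
by rewrite -[n in n - m]card_ord -(cardsC (f @: 'I_m)) leq_subLR leq_add2r.
Qed.

Lemma covered_by_bound n p : covered_by n p -> n <= p.*2.+1.
Proof.
case/covered_byP=> r [c [s [d cov]]].
pose A := ~: [set (r i).2 | i : 'I_p]; pose B := ~: [set (c i).1 | i : 'I_p].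
have card_free : n - p <= minn #|A| #|B|.
  by rewrite leq_min !leq_card_setC_image.
have := @minn_card_le_diagonals n A B
  [seq (sum_no (s i))%:Z%R | i : 'I_p] [seq diff_no (d i) | i : 'I_p].
rewrite !size_image card_ord => bound.
suff /bound : forall x y : 'I_n, x \in B -> y \in A ->
    ((x%:Z + y%:Z)%R \in [seq (sum_no (s i))%:Z%R | i : 'I_p])
    || ((x%:Z - y%:Z)%R \in [seq diff_no (d i) | i : 'I_p]).
  by move: card_free; move: (minn _ _) => k; lia.
move=> x y; rewrite !inE => xB yA; have [i /or4P[]] := cov (x, y).
- move=> /eqP eq_y; case/imsetP: yA; exists i => //; exact/esym/val_inj.
- move=> /eqP eq_x; case/imsetP: xB; exists i => //; exact/esym/val_inj.
- move=> /eqP eq_sum; apply/orP; left; apply/mapP; exists i.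
    by rewrite mem_enum.
  by rewrite eq_sum /sum_no PoszD.
- move=> /eqP eq_diff; apply/orP; right; apply/mapP; exists i.
    by rewrite mem_enum.
  by rewrite eq_diff.
Qed.

Theorem theorem3p1 (n : nat) (n_gt0 : (0 < n)%N) :
  (betaQ n <= gammaQ n)%N /\
  (((n%:R - 1) / 2%:R)%R <= (betaQ n)%:R :> rat)%R.
Proof.
rewrite /betaQ; case: ex_minnP => p cov_p min_p; split.
  rewrite /gammaQ /domination_number.
  case: ex_minnP => _ /existsP[D /andP[domD /eqP<-]] _.
  exact/min_p/covered_by_dominating.
rewrite ler_pdivrMr ?ltr0n // lerBlDr -natrM natr1 ler_nat.
by rewrite muln2 covered_by_bound.
Qed.
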